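(* Let $\mathcal H$ be a separable infinite-dimensional Hilbert space and let $\{g_k\}_{k=1}^\infty$ be any sequence in $\mathcal H$ such that $g_k\to 0$ as $k\to\infty$. Then, given any $\delta>0$, there exists a Riesz basis $\{\psi_k\}_{k=1}^\infty$ for $\mathcal H$ such that $\|g_k-\psi_k\|\le\delta$ for all $k\in\mathbb N$.
   Context: Hilbert spaces are over $\mathbb C$, and $\mathbb N=\{1,2,3,\dots\}$. A sequence $\{g_k\}_{k=1}^\infty$ in $\mathcal H$ is a frame for $\mathcal H$ if there are constants $A,B>0$ with $A\|f\|^2\le\sum_{k=1}^\infty|\langle f,g_k\rangle|^2\le B\|f\|^2$ for all $f\in\mathcal H$. A Riesz basis for $\mathcal H$ is a frame for $\mathcal H$ that is also a (Schauder) basis for $\mathcal H$; equivalently, it is the image of an orthonormal basis of $\mathcal H$ under a bounded bijective operator $\mathcal H\to\mathcal H$. *)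

(* Defs.v *)
From HB Require Import structures.
From mathcomp Require Import all_boot all_order all_algebra.
From mathcomp Require Import all_classical all_reals all_analysis.
From mathcomp Require Import complex.

Set Implicit Arguments.
Unset Strict Implicit.
Unset Printing Implicit Defensive.

Import Order.TTheory GRing.Theory Num.Theory.
Import numFieldNormedType.Exports.

Local Open Scope classical_set_scope.
Local Open Scope ring_scope.
Local Open Scope complex_scope.

(* A complex Hilbert space is a complete normed module H over R[i], with
   R : realType, together with a positive definite Hermitian form
   dot : {dot H for Num.conj} (linear in its first argument) such that
   `|x| ^+ 2 = dot x x. Norms live in R[i] and are nonnegative reals there;
   complex.Re extracts the underlying element of R. A sequence indexed by
   {1, 2, 3, ...} is a function on nat, its k-th term being the value at k - 1. *)

Definition norm_induced_by (R : realType) (H : normedModType R[i])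
    (dot : {dot H for Num.conj}) : Prop :=
  forall x : H, `|x| ^+ 2 = dot x x.

Definition separable (T : topologicalType) : Prop :=
  exists2 D : set T, countable D & dense D.

Definition infinite_dimensional (K : fieldType) (V : lmodType K) : Prop :=
  ~ exists (n : nat) (e : 'I_n -> V),
      forall x : V, exists c : 'I_n -> K, x = \sum_(i < n) c i *: e i.

Definition frame (R : realType) (H : normedModType R[i])
    (dot : {dot H for Num.conj}) (g : H ^nat) : Prop :=
  exists A B : R, [/\ 0 < A, 0 < B & forall f : H,
    ((A * complex.Re `|f| ^+ 2)%:E
       <= \sum_(0 <= k <oo) (complex.Re `|dot f (g k)| ^+ 2)%:E
       <= (B * complex.Re `|f| ^+ 2)%:E)%E].

Definition schauder_basis (K : numFieldType) (V : normedModType K)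
    (e : V ^nat) : Prop :=
  forall f : V, exists! c : K ^nat,
    series (fun k => c k *: e k) @ \oo --> f.

Definition riesz_basis (R : realType) (H : normedModType R[i])
    (dot : {dot H for Num.conj}) (psi : H ^nat) : Prop :=
  frame dot psi /\ schauder_basis psi.

(* Main.v *)
(* All but finitely many g_k, say those with k >= N, have norm at most
   delta / 2.  Apply Gram-Schmidt to g_0, ..., g_(N-1) followed by a dense
   sequence, inserting an arbitrary orthogonal unit vector whenever a residual
   vanishes (possible in infinite dimension).  The resulting (e_k) is an
   orthonormal basis and g_k lies in the span of e_0, ..., e_k for k < N.  Put
   psi_k = g_k + t_k e_k for k < N, where t_k is 0 or delta so that the
   coefficient of psi_k on e_k is nonzero, and psi_k = (delta / 2) e_k for
   k >= N.  Then psi is a finite invertible triangular modification of the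
   Riesz basis ((delta / 2) e_k), hence a Riesz basis. *)

Require Import Defs.
From HB Require Import structures.
From mathcomp Require Import all_boot all_order all_algebra.
From mathcomp Require Import all_classical all_reals all_analysis.
From mathcomp Require Import complex.
From mathcomp Require Import lra.

Import Order.TTheory GRing.Theory Num.Theory.
Import numFieldNormedType.Exports.

Local Open Scope classical_set_scope.
Local Open Scope ring_scope.
Local Open Scope complex_scope.

(** * Recursive choice, finite sums and norm estimates *)

(** Course-of-values choice for Gram-Schmidt: the term at [n] may be chosen using the fact that all
    earlier terms were chosen correctly. *)
Lemma recursive_choice (T : pointedType) (P : nat -> (nat -> T) -> T -> Prop) :
  (forall n e e' u, (forall k, (k < n)%N -> e k = e' k) ->
    P n e u -> P n e' u) ->
  (forall n e, (forall k, (k < n)%N -> P k e (e k)) -> exists u, P n e u) ->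
  exists e, forall n, P n e (e n).
Proof.
move=> Pext Pex.
(* Guarding [P] by correctness of the prefix makes [Q] solvable for every prefix, with [point] as
   the value on bad ones, so plain choice applies. *)
pose Q (ne : nat * (nat -> T)) u :=
  (forall k, (k < ne.1)%N -> P k ne.2 (ne.2 k)) -> P ne.1 ne.2 u.
have [|step stepP] := @choice _ _ Q.
  move=> [n e]; have [/Pex[u Pu]|nP] :=
    pselect (forall k, (k < n)%N -> P k e (e k)); first by exists u.
  by exists point.
(* [E n] is a table whose first [n] entries are final; the sequence is read off its diagonal. *)
pose E := fix E n : nat -> T :=
  if n is n'.+1 then fun k => if k == n' then step (n', E n') else E n' k
  else fun=> point.
have E_stable n k : (k < n)%N -> E n k = E k.+1 k.
  elim: n => // n IH; rewrite ltnS leq_eqVlt => /orP[/eqP->//|kn].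
  by rewrite [LHS]/= ltn_eqF// IH.
pose e k := E k.+1 k.
have eE n : e n = step (n, E n) by rewrite /e /= eqxx.
exists e => n; elim/ltn_ind: n => n IH; rewrite eE.
apply: (Pext n (E n)); first exact: E_stable.
apply: (stepP (n, E n)) => k kn /=; rewrite E_stable//.
by apply: Pext (IH k kn) => j jk; rewrite [RHS]E_stable// (ltn_trans jk).
Qed.

Lemma sum_ord_truncate {V : nmodType} (m n : nat) (F : nat -> V) :
  (m <= n)%N -> (forall k, (m <= k)%N -> F k = 0) ->
  \sum_(k < n) F k = \sum_(k < m) F k.
Proof.
move=> mn F0; rewrite (big_ord_widen _ _ mn) [RHS]big_mkcond.
by apply: eq_bigr => k _; case: ltnP => // /F0.
Qed.

Lemma sum_ord_delta {K : pzRingType} {V : lmodType K} (n m : nat)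
    (F : nat -> V) :
  (m < n)%N -> \sum_(k < n) (k == m :> nat)%:R *: F k = F m.
Proof.
move=> mn; rewrite (bigD1 (Ordinal mn))//= eqxx scale1r big1 ?addr0// => k km.
by rewrite (_ : (_ == _) = false) ?scale0r//; apply/negbTE.
Qed.

Lemma Re_norm_sqr {R : realType} (z : R[i]) :
  complex.Re `|z| ^+ 2 = complex.Re z ^+ 2 + complex.Im z ^+ 2.
Proof. by rewrite normc_def /= sqr_sqrtr// addr_ge0 ?sqr_ge0. Qed.

Lemma norm_Re {R : realType} {V : normedZmodType R[i]} (x : V) :
  (complex.Re `|x|)%:C = `|x|.
Proof.
by have := normr_ge0 x; rewrite lecE /= => /andP[/eqP]; case: `|x| => a b /= ->.
Qed.

Lemma norm_sqr_Re {R : realType} {V : normedZmodType R[i]} (x : V) :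
  (complex.Re `|x| ^+ 2)%:C = `|x| ^+ 2.
Proof. by rewrite -[in RHS](norm_Re x) -rmorphXn. Qed.

Lemma Re_normM {R : realType} (z w : R[i]) :
  complex.Re `|z * w| = complex.Re `|z| * complex.Re `|w|.
Proof.
by rewrite normrM -[in LHS](norm_Re z) -[in LHS](norm_Re w) -rmorphM.
Qed.

(** Induction on [n] with $|s+t|^2 \le 2|s|^2 + 2|t|^2$. The constant is crude; what matters is that
    it does not depend on [x]. *)
Lemma norm_sqr_comb {R : realType} (n : nat) (b : nat -> R[i]) :
  exists2 K : R, 0 <= K & forall x : nat -> R[i],
    complex.Re `|\sum_(j < n) b j * x j| ^+ 2 <=
      K * \sum_(j < n) complex.Re `|x j| ^+ 2.
Proof.
elim: n => [|n [K K0 IH]].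
  by exists 0 => // x; rewrite !big_ord0 normr0 mulr0 expr0n.
exists (2 * K + 2 * complex.Re `|b n| ^+ 2) => [|x].
  by rewrite addr_ge0// mulr_ge0// sqr_ge0.
rewrite !big_ord_recr/=; have := IH x.
set S := \sum_(j < n) _; set T := \sum_(j < n) _ => leT.
have T0 : 0 <= T by apply: sumr_ge0 => j _; exact: sqr_ge0.
apply: (@le_trans _ _ (2 * complex.Re `|S| ^+ 2 +
    2 * complex.Re `|b n * x n| ^+ 2)).
  rewrite !Re_norm_sqr !raddfD /=.
  set p := complex.Re S; set q := complex.Im S.
  set r := complex.Re (b n * x n); set s := complex.Im (b n * x n).
    have := sqr_ge0 (p - r); have := sqr_ge0 (q - s); nra.
rewrite Re_normM exprMn.
have : 0 <= K * complex.Re `|x n| ^+ 2 by rewrite mulr_ge0// sqr_ge0.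
have : 0 <= complex.Re `|b n| ^+ 2 * T by rewrite mulr_ge0// sqr_ge0.
rewrite -[Normc.normc (b n)]/(complex.Re `|b n|)
  -[Normc.normc (x n)]/(complex.Re `|x n|).
nra.
Qed.

(** The head costs a factor [K] and the unchanged tail a factor 1; [K + 1] dominates both. *)
Lemma nneseries_le_head {R : realType} (n : nat) (K : R) (u v : nat -> R) :
  0 <= K -> (forall k, 0 <= u k) -> (forall k, 0 <= v k) ->
  (forall k, (n <= k)%N -> v k = u k) ->
  \sum_(k < n) v k <= K * \sum_(k < n) u k ->
  (\sum_(0 <= k <oo) (v k)%:E <= (K + 1)%:E * \sum_(0 <= k <oo) (u k)%:E)%E.
Proof.
move=> K0 u0 v0 vu le_head; rewrite -nneseriesZl; last first.
  by move=> k _; rewrite lee_fin.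
apply: lee_lim.
- by apply: is_cvg_nneseries => k _ _; rewrite lee_fin.
- by apply: is_cvg_nneseries => k _ _; rewrite mule_ge0// lee_fin// addr_ge0.
near=> N; rewrite !sumEFin lee_fin -mulr_sumr.
have nN : (n <= N)%N by near: N; exact: nbhs_infty_ge.
rewrite (big_cat_nat (leq0n n) nN) (big_cat_nat (leq0n n) nN) /= !big_mkord.
rewrite [X in _ + X](_ : _ = \sum_(n <= k < N) u k); last first.
  by apply: eq_big_nat => k /andP[/vu].
have head0 : 0 <= \sum_(k < n) u k by rewrite sumr_ge0.
have tail0 : 0 <= \sum_(n <= k < N) u k by rewrite sumr_ge0.
have := mulr_ge0 K0 tail0; nra.
Unshelve. all: by end_near. Qed.

(** * Orthogonal projections and Gram-Schmidt *)

Section GramSchmidt.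
Context {R : realType} {H : normedModType R[i]} (dot : {dot H for Num.conj}).

Definition orthonormal_below (e : H ^nat) (n : nat) : Prop :=
  forall j k, (j < n)%N -> (k < n)%N -> dot (e j) (e k) = (j == k)%:R.

Definition proj (e : H ^nat) (n : nat) (f : H) : H :=
  \sum_(k < n) dot f (e k) *: e k.

Lemma dot_suml (I : Type) (r : seq I) (F : I -> H) (y : H) :
  dot (\sum_(i <- r) F i) y = \sum_(i <- r) dot (F i) y.
Proof.
by apply: (big_morph (fun x => dot x y)) => [u v|]; rewrite ?linearDl ?linear0l.
Qed.

Lemma dot_sumZr (n : nat) (a : nat -> R[i]) (F : H ^nat) (x : H) :
  dot x (\sum_(j < n) a j *: F j) = \sum_(j < n) (a j)^*%R * dot x (F j).
Proof. by rewrite raddf_sum /=; apply: eq_bigr => j _; rewrite linearZr_LR. Qed.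

Lemma dot_conj (x y : H) : dot x y = (dot y x)^*%R.
Proof. exact: etrans (hermC dot x y) (mul1r _). Qed.

Lemma dot_eq0C (x y : H) : dot x y = 0 -> dot y x = 0.
Proof. by move=> xy0; rewrite dot_conj xy0 conjC0. Qed.

Lemma dot_projr e n f x :
  dot x (proj e n f) = \sum_(k < n) (dot f (e k))^*%R * dot x (e k).
Proof. exact: dot_sumZr n (fun k => dot f (e k)) e x. Qed.

Lemma projB e n f h : proj e n (f - h) = proj e n f - proj e n h.
Proof.
by rewrite /proj -sumrB; apply: eq_bigr => k _; rewrite linearBl scalerBl.
Qed.

Lemma dot_proj e n f j : orthonormal_below e n -> (j < n)%N ->
  dot (proj e n f) (e j) = dot f (e j).
Proof.
move=> oe jn; rewrite dot_suml (bigD1 (Ordinal jn)) //= linearZl_LR /= oe//.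
rewrite eqxx mulr1 big1 ?addr0// => k kj; rewrite linearZl_LR /= oe//.
by rewrite (_ : (_ == _) = false) ?mulr0//; apply/negbTE.
Qed.

Lemma dot_residual e n f j : orthonormal_below e n -> (j < n)%N ->
  dot (f - proj e n f) (e j) = 0.
Proof. by move=> oe jn; rewrite linearBl /= dot_proj// subrr. Qed.

(** Pythagoras: the residual is orthogonal to the projection. *)
Lemma dnorm_proj e n f : orthonormal_below e n ->
  dot f f = dot (f - proj e n f) (f - proj e n f)
            + \sum_(k < n) `|dot f (e k)| ^+ 2.
Proof.
move=> oe; set h := f - _.
have hp : dot h (proj e n f) = 0.
  rewrite dot_projr big1// => k _.
  by rewrite /h dot_residual// mulr0.
have pp : dot (proj e n f) (proj e n f) = \sum_(k < n) `|dot f (e k)| ^+ 2.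
  rewrite dot_projr; apply: eq_bigr => k _.
  by rewrite dot_proj// normCK mulrC.
by rewrite -[f in LHS](subrK (proj e n f)) -/h hnormDd//= pp.
Qed.

Lemma norm_dot_le_unit (x u : H) : dot u u = 1 -> `|dot x u| ^+ 2 <= dot x x.
Proof.
move=> u1; rewrite (@dnorm_proj (fun=> u) 1).
  by rewrite big_ord1 lerDr dnorm_ge0.
by move=> [|j] [|k].
Qed.

Lemma exists_normalization {h : H} : h != 0 ->
  exists2 a, a != 0 & dot (a^-1 *: h) (a^-1 *: h) = 1.
Proof.
move=> h0; exists (sqrtC (dot h h)); first by rewrite sqrt_dnorm_eq0.
rewrite dnormZ normfV exprVn -normrX sqrtCK ger0_norm ?dnorm_ge0//.
by rewrite mulVf// dnorm_eq0.
Qed.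

Hypothesis Hdim : infinite_dimensional H.

(** If every residual vanished, the first [n] vectors would span [H], against infinite dimension; a
    nonzero residual is normalized. *)
Lemma exists_unit_orthogonal e n : orthonormal_below e n ->
  exists2 u, dot u u = 1 & forall j, (j < n)%N -> dot u (e j) = 0.
Proof.
move=> oe.
have [f fP] : exists f, f - proj e n f != 0.
  apply: contrapT => nf; apply: Hdim; exists n, (fun i : 'I_n => e i) => f.
  exists (fun i : 'I_n => dot f (e i)); apply/eqP; rewrite -subr_eq0.
  by apply: contrapT => /negP f0; apply: nf; exists f.
have [a _ a1] := exists_normalization fP.
exists (a^-1 *: (f - proj e n f)) => // j jn.
by rewrite linearZl_LR /= dot_residual// mulr0.
Qed.

Lemma exists_unit_residual e n v : orthonormal_below e n ->
  exists u, [/\ dot u u = 1, forall j, (j < n)%N -> dot u (e j) = 0 &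
    exists c, v - proj e n v = c *: u].
Proof.
move=> oe; have [h0|hN0] := eqVneq (v - proj e n v) 0.
  have [u u1 uo] := exists_unit_orthogonal _ _ oe.
  by exists u; split => //; exists 0; rewrite scale0r.
have [a a0 a1] := exists_normalization hN0.
exists (a^-1 *: (v - proj e n v)); split => [//|j jn|].
- by rewrite linearZl_LR /= dot_residual// mulr0.
- by exists a; rewrite scalerA divff// scale1r.
Qed.

Definition orthonormal_seq (e : H ^nat) : Prop :=
  forall j k, dot (e j) (e k) = (j == k)%:R.

(** Each new vector is the normalized residual of [v n], or any orthogonal unit vector when that
    residual is zero. This keeps the indices aligned: [v n] lies in the span of [e 0], ..., [e n],
    even for dependent [v]. *)
Lemma gram_schmidt (v : H ^nat) : exists2 e, orthonormal_seq e &
  forall n, v n = proj e n.+1 (v n).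
Proof.
pose P n e u := [/\ dot u u = 1, forall j, (j < n)%N -> dot u (e j) = 0 &
    exists c, v n - proj e n (v n) = c *: u].
have Portho e n : (forall k, (k < n)%N -> P k e (e k)) -> orthonormal_below e n.
  move=> Pe j k jn kn; case: (ltngtP j k) => [jk|kj|->].
  - by have [_ /(_ j jk) /dot_eq0C ->] := Pe k kn.
  - by have [_ /(_ k kj) ->] := Pe j jn.
  - by have [-> _ _] := Pe k kn.
have [||e Pe] := @recursive_choice H P.
- move=> n e e' u ee' [u1 uo [c vc]]; split => //.
    by move=> j jn; rewrite -ee'// uo.
  exists c; rewrite -vc; congr (_ - _).
  by apply: eq_bigr => k _; rewrite ee'.
- by move=> n e /Portho oe; exact: exists_unit_residual.
have oe n : orthonormal_below e n by apply: Portho => k _; exact: Pe.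
exists e => [j k|n].
  by apply: (oe (maxn j k).+1); rewrite ltnS leq_max leqnn ?orbT.
have [u1 uo [c vc]] := Pe n.
have -> : proj e n.+1 (v n) = proj e n (v n) + dot (v n) (e n) *: e n.
  by rewrite /proj big_ord_recr.
(* The projection part of [v n] is orthogonal to [e n], so only the residual [c *: e n]
   contributes. *)
suff -> : dot (v n) (e n) = c by rewrite -vc addrC subrK.
rewrite -[v n in LHS](subrK (proj e n (v n))) vc linearDl.
rewrite linearZl_LR /= u1 mulr1.
rewrite dot_eq0C ?addr0// dot_projr big1// => k _.
by rewrite uo ?mulr0.
Qed.

End GramSchmidt.

(** * Transfer of frames and bases; total orthonormal sequences *)

Section OrthonormalRiesz.
Context {R : realType} {H : normedModType R[i]} {dot : {dot H for Num.conj}}.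
Hypothesis Hdot : norm_induced_by dot.

(** The bijection [G] turns [psi]-coefficients into [phi]-coefficients with eventually equal partial
    sums, so expansions of [f] correspond one to one. *)
Lemma schauder_basis_transfer (phi psi : H ^nat)
    (F G : R[i] ^nat -> R[i] ^nat) :
  cancel F G -> cancel G F ->
  (forall d, \forall n \near \oo,
    series (fun k => d k *: psi k) n = series (fun k => G d k *: phi k) n) ->
  schauder_basis phi -> schauder_basis psi.
Proof.
move=> FK GK serE basis f; have [c [cf c_uniq]] := basis f.
exists (F c); split => [|d df].
  apply: cvg_trans cf; apply: near_eq_cvg.
  by apply: filterS (serE (F c)) => n ->; rewrite FK.
rewrite (c_uniq (G d)) ?GK//.
apply: cvg_trans df; apply: near_eq_cvg.
by apply: filterS (serE d) => n ->.
Qed.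

Lemma schauder_basis_scale (phi : H ^nat) (a : R[i]) : a != 0 ->
  schauder_basis phi -> schauder_basis (fun k => a *: phi k).
Proof.
move=> a0; apply: (@schauder_basis_transfer _ _
  (fun c k => c k / a) (fun d k => d k * a)) => [c|d|d].
- by apply/funext => k; rewrite divfK.
- by apply/funext => k; rewrite mulfK.
- by apply: nearW => n; apply: eq_bigr => k _; rewrite scalerA.
Qed.

Lemma frame_transfer (phi psi : H ^nat) (C D : R) : 0 < C -> 0 < D ->
  (forall f, (\sum_(0 <= k <oo) (complex.Re `|dot f (psi k)| ^+ 2)%:E <=
    C%:E * \sum_(0 <= k <oo) (complex.Re `|dot f (phi k)| ^+ 2)%:E)%E) ->
  (forall f, (\sum_(0 <= k <oo) (complex.Re `|dot f (phi k)| ^+ 2)%:E <=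
    D%:E * \sum_(0 <= k <oo) (complex.Re `|dot f (psi k)| ^+ 2)%:E)%E) ->
  frame dot phi -> frame dot psi.
Proof.
move=> C0 D0 leC leD [A [B [A0 B0 fr]]].
exists (D^-1 * A), (C * B); split; rewrite ?mulr_gt0 ?invr_gt0// => f.
have /andP[Af fB] := fr f; apply/andP; split.
  rewrite -mulrA EFinM lee_pdivrMl//; exact: le_trans Af (leD f).
apply: le_trans (leC f) _; rewrite -mulrA EFinM.
by rewrite lee_pmul2l.
Qed.

Lemma riesz_basis_scale (phi : H ^nat) (a : R[i]) : a != 0 ->
  riesz_basis dot phi -> riesz_basis dot (fun k => a *: phi k).
Proof.
move=> a0 [fr sch]; split; last exact: schauder_basis_scale.
have na : 0 < complex.Re `|a| ^+ 2.
  by rewrite exprn_gt0// -ltcR norm_Re normr_gt0.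
have E f k : complex.Re `|dot f (a *: phi k)| ^+ 2 =
    complex.Re `|a| ^+ 2 * complex.Re `|dot f (phi k)| ^+ 2.
  have -> : dot f (a *: phi k) = a^*%R * dot f (phi k) by rewrite linearZr_LR.
  by rewrite Re_normM norm_conjC exprMn.
have ser f : (\sum_(0 <= k <oo) (complex.Re `|dot f (a *: phi k)| ^+ 2)%:E =
    (complex.Re `|a| ^+ 2)%:E *
      \sum_(0 <= k <oo) (complex.Re `|dot f (phi k)| ^+ 2)%:E)%E.
  rewrite -nneseriesZl; last by move=> k _; rewrite lee_fin sqr_ge0.
  by apply: eq_eseriesr => k _; rewrite E EFinM.
apply: (frame_transfer _ _ (complex.Re `|a| ^+ 2)
  (complex.Re `|a| ^+ 2)^-1 _ _ _ _ fr).
- exact: na.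
- by rewrite invr_gt0.
- by move=> f; rewrite ser.
- by move=> f; rewrite ser muleA -EFinM mulVf ?mul1e// gt_eqF.
Qed.

Context (e : H ^nat).
Hypotheses (oe : orthonormal_seq dot e)
  (e_total : forall f : H, proj dot e n f @[n --> \oo] --> f).

Lemma norm_le_dot (x y : H) : dot x x <= dot y y -> `|x| <= `|y|.
Proof. by rewrite -!Hdot ler_sqr ?nnegrE. Qed.

Lemma norm_dot_le (x u : H) : dot u u = 1 -> `|dot x u| <= `|x|.
Proof.
move=> u1; rewrite -ler_sqr ?nnegrE// Hdot; exact: norm_dot_le_unit.
Qed.

Lemma orthonormal_schauder : schauder_basis e.
Proof.
move=> f; exists (fun k => dot f (e k)); split => [|c cf].
  by apply: cvg_trans (e_total f); apply: near_eq_cvg; apply: nearW => n;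
    rewrite /series /= big_mkord.
(* Uniqueness: [c j] is the inner product with [e j] of any partial sum longer than [j], so its
   distance to [dot f (e j)] is at most the distance of [f] to that partial sum. *)
apply/funext => j; apply/eqP; rewrite -subr_eq0 -normr_le0.
apply/ler_addgt0Pr => eps eps0; rewrite add0r.
have /cvgrPdist_le /(_ eps eps0) cfe := cf.
have /filter_ex[n [jn fn]] : \forall n \near \oo, (j < n)%N /\
    `|f - series (fun k => c k *: e k) n| <= eps.
  by near=> n; split; near: n => //; exact: nbhs_infty_gt.
apply: le_trans fn; have -> : c j = dot (series (fun k => c k *: e k) n) (e j).
  rewrite /series /= big_mkord dot_suml (bigD1 (Ordinal jn)) //= linearZl_LR /=.
  rewrite oe eqxx mulr1 big1 ?addr0// => k kj; rewrite linearZl_LR /= oe.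
  by rewrite (_ : (_ == _) = false) ?mulr0//; apply/negbTE.
by rewrite -linearBl norm_dot_le// oe eqxx.
Unshelve. all: by end_near. Qed.

Lemma orthonormal_bessel (n : nat) (f : H) :
  complex.Re `|f| ^+ 2 = complex.Re `|f - proj dot e n f| ^+ 2 +
    \sum_(k < n) complex.Re `|dot f (e k)| ^+ 2.
Proof.
apply: complexI; rewrite norm_sqr_Re Hdot (@dnorm_proj _ _ _ e n)//.
rewrite rmorphD -Hdot; congr (_ + _); first exact/esym/norm_sqr_Re.
by rewrite rmorph_sum; apply: eq_bigr => k _; exact/esym/norm_sqr_Re.
Qed.

(** Parseval with both bounds 1: totality gives the lower one, Bessel the upper one. *)
Lemma orthonormal_frame : frame dot e.
Proof.
exists 1, 1; split; rewrite ?ltr01// => f; rewrite mul1r; apply/andP; split.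
  apply/lee_addgt0Pr => eps eps0.
  (* since t <= 1, a residual of norm at most t has square at most t <= eps *)
  pose t := Num.min eps 1; have t0 : 0 < t by rewrite lt_min eps0 ltr01.
  have /cvgrPdist_le /(_ t%:C) := e_total f.
  rewrite ltcR => /(_ t0) /filter_ex[n /=]; rewrite -norm_Re lecR => fn.
  apply: (@le_trans _ _
      (\sum_(k < n) complex.Re `|dot f (e k)| ^+ 2 + eps)%:E).
    rewrite lee_fin (orthonormal_bessel n f) addrC lerD2l.
    have := normr_ge0 (f - proj dot e n f); rewrite -norm_Re lecR => fn0.
    have : t <= eps by rewrite ge_min lexx.
    have : t <= 1 by rewrite ge_min lexx orbT.
    nra.
  rewrite EFinD leeD2r//.
  rewrite -(big_mkord xpredT (fun k => complex.Re `|dot f (e k)| ^+ 2)).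
  rewrite -sumEFin; apply: nneseries_lim_ge => k _ _.
  by rewrite lee_fin sqr_ge0.
apply: lime_le.
  by apply: is_cvg_nneseries => k _ _; rewrite lee_fin sqr_ge0.
apply: nearW => n; rewrite sumEFin big_mkord lee_fin (orthonormal_bessel n f).
by rewrite lerDr sqr_ge0.
Qed.

End OrthonormalRiesz.

(** * Finite triangular modifications of a Riesz basis *)

Section Triangular.
Context {R : realType} {H : normedModType R[i]} {dot : {dot H for Num.conj}}.

(** Only the first [n] terms of the series change, through a finite matrix; its entries appear
    conjugated because [dot] is conjugate-linear on the right. *)
Lemma nneseries_dot_comb (phi psi : H ^nat) (n : nat) (a : nat -> nat -> R[i]) :
  (forall k, (k < n)%N -> psi k = \sum_(j < n) a k j *: phi j) ->
  (forall k, (n <= k)%N -> psi k = phi k) ->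
  exists2 C : R, 0 < C & forall f,
    (\sum_(0 <= k <oo) (complex.Re `|dot f (psi k)| ^+ 2)%:E <=
      C%:E * \sum_(0 <= k <oo) (complex.Re `|dot f (phi k)| ^+ 2)%:E)%E.
Proof.
move=> psi_lt psi_ge.
have [k|K KP] := @choice _ _ (fun k (Kk : R) =>
    0 <= Kk /\ forall x : nat -> R[i],
      complex.Re `|\sum_(j < n) (a k j)^*%R * x j| ^+ 2 <=
        Kk * \sum_(j < n) complex.Re `|x j| ^+ 2).
  by have [Kk Kk0 KkP] := norm_sqr_comb n (fun j => (a k j)^*%R); exists Kk.
have sumK0 : 0 <= \sum_(k < n) K k by apply: sumr_ge0 => k _; have [] := KP k.
exists (\sum_(k < n) K k + 1) => [|f]; first by rewrite ltr_wpDl.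
apply: (@nneseries_le_head _ n) => //.
- by move=> k; exact: sqr_ge0.
- by move=> k; exact: sqr_ge0.
- by move=> k nk; rewrite psi_ge.
rewrite mulr_suml; apply: ler_sum => k _.
by rewrite psi_lt// dot_sumZr; exact: (KP k).2 (fun j => dot f (phi j)).
Qed.

(** The elementary step: [b m != 0] lets [phi m] be solved for in terms of the new family, which
    gives estimates and coefficient maps in both directions. *)
Lemma riesz_basis_replace (phi : H ^nat) (m : nat) (b : R[i] ^nat) :
  b m != 0 -> riesz_basis dot phi ->
  riesz_basis dot
    (fun k => if k == m then \sum_(j < m.+1) b j *: phi j else phi k).
Proof.
move=> bm0 [fr sch]; set h := \sum_(j < m.+1) _; set psi := fun k => _.
(* Cutting [b] off after [m] writes [h] as a sum over any range longer than [m]. *)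
pose b' k := if (k <= m)%N then b k else 0.
have b'm : b' m = b m by rewrite /b' leqnn.
have hE n : (m < n)%N -> h = \sum_(k < n) b' k *: phi k.
  move=> mn; rewrite (@sum_ord_truncate _ m.+1 n (fun k => b' k *: phi k))//.
    by apply: eq_bigr => j _; rewrite /b' -ltnS ltn_ord.
  by move=> k mk; rewrite /b' leqNgt mk scale0r.
have psiE k : psi k = phi k + (k == m)%:R *: (h - phi m).
  rewrite /psi; case: eqVneq => [->|_]; last by rewrite scale0r addr0.
  by rewrite scale1r addrC subrK.
split.
(* [a] expresses [psi] over [phi]; [a'] is the inverse matrix, whose row [m] comes from solving the
   formula for [h] for [phi m]. *)
- pose a k j : R[i] := if k == m then b j else (j == k)%:R.
  pose a' k j : R[i] := if k == m then
    (if j == m then (b m)^-1 else - (b m)^-1 * b j) else (j == k)%:R.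
  have [||C C0 CP] := nneseries_dot_comb phi psi m.+1 a.
  + move=> k km; rewrite /psi /a; case: ifP => // _; exact/esym/sum_ord_delta.
  + by move=> k mk; rewrite /psi gtn_eqF.
  have [||D D0 DP] := nneseries_dot_comb psi phi m.+1 a'.
  + move=> k km; rewrite /a'; case: eqP => [->|/eqP kNm].
      rewrite big_ord_recr /= eqxx /psi eqxx /h big_ord_recr /=.
      rewrite scalerDr scalerA mulVf// scale1r scaler_sumr addrA -big_split /=.
      rewrite big1 ?add0r// => j _; rewrite ltn_eqF// scalerA mulNr scaleNr.
      by rewrite addNr.
    rewrite [LHS](_ : _ = psi k); last by rewrite /psi (negbTE kNm).
    exact/esym/sum_ord_delta.
  + by move=> k mk; rewrite /psi gtn_eqF.
  exact: frame_transfer C D C0 D0 CP DP fr.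
(* Since [psi m] is [phi m + (h - phi m)], a coefficient [d m] adds [d m] times the coordinates of
   [h - phi m]. The new coordinate at [m] is [d m * b m], hence the division by [b m] in the
   inverse. *)
- apply: (@schauder_basis_transfer _ _ phi psi
    (fun c k => c k + c m / b m * ((k == m)%:R - b' k))
    (fun d k => d k + d m * (b' k - (k == m)%:R))) => // [c|d|d].
  + apply/funext => k; rewrite /= eqxx b'm mulr1n (mulrBr _ 1) mulr1 divfK//.
    rewrite [c m + _]addrC subrK -addrA -mulrDr addrA subrK subrr mulr0.
    exact: addr0.
  + apply/funext => k; rewrite /= eqxx b'm mulr1n (mulrBr _ (b m)) mulr1.
    rewrite [d m + _]addrC subrK mulfK// -addrA -mulrDr.
    by rewrite addrA subrK subrr mulr0 addr0.
  near=> n; have mn : (m < n)%N by near: n; exact: nbhs_infty_gt.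
  rewrite /series /= !big_mkord.
  under eq_bigr do rewrite psiE scalerDr.
  under [RHS]eq_bigr do rewrite scalerDl.
  rewrite !big_split /=; congr (_ + _).
  under [RHS]eq_bigr do rewrite -scalerA scalerBl.
  rewrite -scaler_sumr sumrB -hE// (@sum_ord_delta _ _ n m phi)// scalerBr.
  under eq_bigr do rewrite scalerA mulrC -scalerA.
  by rewrite (@sum_ord_delta _ _ n m (fun k => d k *: (h - phi m)))//
    scalerBr.
Unshelve. all: by end_near. Qed.

(* Replacing index N first keeps phi_0, ..., phi_(N-1) intact, so the remaining
   psi_k are still triangular over the modified basis. *)
Lemma riesz_basis_triangular (N : nat) (phi psi : H ^nat)
    (a : nat -> nat -> R[i]) :
  (forall k, (k < N)%N -> a k k != 0) ->
  (forall k, (k < N)%N -> psi k = \sum_(j < k.+1) a k j *: phi j) ->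
  (forall k, (N <= k)%N -> psi k = phi k) ->
  riesz_basis dot phi -> riesz_basis dot psi.
Proof.
elim: N phi => [|N IH] phi a0 psi_lt psi_ge rphi.
  by rewrite (_ : psi = phi)//; apply/funext => k; rewrite psi_ge.
have := riesz_basis_replace phi N (a N) (a0 N (leqnn _)) rphi.
apply: IH => k kN; first by rewrite a0// ltnW.
  rewrite psi_lt ?ltnS 1?ltnW//; apply: eq_bigr => j _.
  by rewrite ltn_eqF// (leq_trans _ kN)// ltn_ord.
case: eqVneq => [->|kNN]; first exact: psi_lt.
by rewrite psi_ge// ltn_neqAle eq_sym kNN.
Qed.

End Triangular.

(** * Totality from density, and the construction of the basis *)

Lemma separable_dense_seq {R : realType} {H : normedModType R[i]} :
  separable H -> exists d : H ^nat, forall (f : H) (eps : R), 0 < eps ->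
    exists n, `|f - d n| < eps%:C.
Proof.
move=> [D /countable_injP[r r_inj] Ddense].
(* The injection [r] into the naturals is inverted; numbers that are not codes of points of [D] get
   the default 0. *)
exists (fun n => xget 0 [set x | D x /\ r x = n]) => f eps eps0.
have epsC0 : 0 < eps%:C by rewrite ltcR.
have [|x [fx Dx]] := Ddense (ball f eps%:C) _ (ball_open _ _).
  by exists f; exact: ballxx.
exists (r x).
suff -> : xget 0 [set y | D y /\ r y = r x] = x.
  by move: fx; rewrite -ball_normE.
by apply: xget_unique => // y [Dy]; apply: r_inj; rewrite inE.
Qed.

(** Once [n > m], the projection fixes [v m], so the residual of [f] is that of [f - v m], which by
    Pythagoras is no longer than [f - v m]. *)
Lemma proj_cvg {R : realType} {H : normedModType R[i]}
    {dot : {dot H for Num.conj}} (e v : H ^nat) :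
  norm_induced_by dot -> orthonormal_seq dot e ->
  (forall n, v n = proj dot e n.+1 (v n)) ->
  (forall (f : H) (eps : R), 0 < eps -> exists n, `|f - v n| < eps%:C) ->
  forall f, proj dot e n f @[n --> \oo] --> f.
Proof.
move=> Hdot oe vE v_dense f; apply/cvgrPdist_le => eps eps0.
have epsE : eps = (complex.Re eps)%:C by rewrite -[eps]gtr0_norm// norm_Re.
have [m fm] := v_dense f (complex.Re eps) ltac:(by rewrite -ltcR -epsE).
near=> n; have mn : (m < n)%N by near: n; exact: nbhs_infty_gt.
have vm : proj dot e n (v m) = v m.
  have dot0 j : (m < j)%N -> dot (v m) (e j) = 0.
    move=> mj; rewrite vE dot_suml big1// => k _; rewrite linearZl_LR /= oe.
    by rewrite ltn_eqF ?mulr0// (leq_trans _ mj).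
  rewrite [RHS]vE /proj.
  apply: (@sum_ord_truncate _ m.+1 n (fun k => dot (v m) (e k) *: e k)) => // k.
  by move=> mk; rewrite dot0// scale0r.
have -> : f - proj dot e n f = (f - v m) - proj dot e n (f - v m).
  by rewrite projB vm opprB addrA subrK.
rewrite epsE; apply: le_trans (ltW fm).
apply: norm_le_dot => //; rewrite [leRHS](@dnorm_proj _ _ _ e n)//.
by rewrite lerDl sumr_ge0// => k _; rewrite exprn_ge0.
Unshelve. all: by end_near. Qed.

Theorem theorem3p1 (R : realType) (H : completeNormedModType R[i])
    (dot : {dot H for Num.conj}) (Hdot : norm_induced_by dot)
    (Hsep : separable H) (Hdim : infinite_dimensional H)
    (g : H ^nat) (Hg : g @ \oo --> (0 : H))
    (delta : R) (Hdelta : 0 < delta) :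
  exists psi : H ^nat,
    riesz_basis dot psi /\ forall k : nat, `|g k - psi k| <= delta%:C.
Proof.
(* Half of [delta] bounds the tail of [g], the other half is the length of the tail vectors of
   [psi]. *)
pose c : R[i] := (delta / 2)%:C.
have c0 : 0 < c by rewrite ltcR divr_gt0.
have cN0 : c != 0 by rewrite gt_eqF.
have cc : delta%:C = c + c by rewrite -rmorphD -splitr.
have [N _ gN] : \forall k \near \oo, `|g k| <= c.
  have /cvgrPdist_le /(_ c c0) := Hg.
  by apply: filterS => k; rewrite sub0r normrN.
have [d dP] := separable_dense_seq Hsep.
(* Putting [g] first places [g k] in the span of [e 0], ..., [e k] for [k < N]; the shifted [d]
   keeps [v] dense. *)
pose v k := if (k < N)%N then g k else d (k - N)%N.
have [e oe vE] := gram_schmidt dot Hdim v.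
have e1 k : `|e k| = 1.
  by apply/eqP; rewrite -sqrp_eq1// Hdot oe eqxx.
have e_total : forall f, proj dot e n f @[n --> \oo] --> f.
  apply: (proj_cvg e v Hdot oe vE).
  move=> f eps eps0; have [n fn] := dP f eps eps0.
  by exists (N + n)%N; rewrite /v ltnNge leq_addr /= addKn.
pose t k : R[i] := if dot (g k) (e k) == 0 then delta%:C else 0.
pose psi k := if (k < N)%N then g k + t k *: e k else c *: e k.
exists psi; split => [|k].
(* Coordinates of [psi k] over the scaled basis [c *: e j], hence the division by [c]. On the
   diagonal, [t k] is added exactly when [dot (g k) (e k)] vanishes. *)
- pose a k j := (dot (g k) (e j) + (j == k)%:R * t k) / c.
  apply: (riesz_basis_triangular N (fun k => c *: e k) psi a)
    => [k kN|k kN|k Nk|].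
  + rewrite /a eqxx mul1r mulf_neq0 ?invr_neq0// /t.
    case: (eqVneq (dot (g k) (e k)) 0) => [->|gk0]; last by rewrite addr0.
    by rewrite add0r gt_eqF// ltcR.
  + have gE : g k = proj dot e k.+1 (g k) by have := vE k; rewrite /v kN.
    under eq_bigr do rewrite /a scalerA (divfK cN0) scalerDl.
    rewrite big_split /= -[X in X + _]gE /psi kN; congr (_ + _).
    rewrite big_ord_recr /= eqxx mul1r big1 ?add0r// => j _.
    by rewrite ltn_eqF// mul0r scale0r.
  + by rewrite /psi ltnNge Nk.
  + apply: riesz_basis_scale => //.
    split; [exact: orthonormal_frame|exact: orthonormal_schauder].
(* Below [N] the error is [t k *: e k], of norm 0 or [delta]; from [N] on, the triangle inequality
   gives at most [c + c]. *)
- rewrite /psi; case: ltnP => [_|Nk].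
    rewrite opprD addNKr normrN normrZ e1 mulr1 /t.
    have d0 : 0 <= delta%:C by rewrite lecR ltW.
    by case: ifP => _; rewrite ?normr0// ger0_norm.
  apply: le_trans (ler_normB _ _) _; rewrite normrZ e1 mulr1 cc.
  by rewrite (gtr0_norm c0) lerD2r; exact: gN.
Qed.
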